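(* For any formulas $\phi$ and $\psi$ in the language of $\mathbf{CPL}^+$: if $\phi\models\psi$ then $\phi\vdash\psi$ in the natural deduction system of $\mathbf{CPL}^+$.
   Context: Formulas of $\mathbf{CPL}^+$: $\phi::=p_i\mid\neg p_i\mid\bot\mid\mathrm{NE}\mid\phi\wedge\phi\mid\phi\otimes\phi$. A valuation on $N\subseteq\mathbb N$ is $s:N\to\{0,1\}$, a team on $N$ a set of such (a team: on $\mathbb N$). Semantics: $X\models p_i$ iff $s(i)=1$ for all $s\in X$; $X\models\neg p_i$ iff $s(i)=0$ for all $s\in X$; $X\models\bot$ iff $X=\emptyset$; $X\models\mathrm{NE}$ iff $X\neq\emptyset$; $\wedge$ as usual; $X\models\phi\otimes\psi$ iff $X=Y\cup Z$ for some $Y,Z\subseteq X$ with $Y\models\phi$, $Z\models\psi$. $\phi\models\psi$: every team satisfying $\phi$ satisfies $\psi$. Classical formulas: those without $\mathrm{NE}$. $p_i^1=p_i$, $p_i^0=\neg p_i$; empty $\otimes$-disjunction is $\bot$; for a team $X$ on finite $N=\{i_1,\dots,i_n\}$, $\Theta^*_X=\bigotimes_{s\in X}(p_{i_1}^{s(i_1)}\wedge\dots\wedge p_{i_n}^{s(i_n)}\wedge\mathrm{NE})$. A formula is viewed as a string of symbols numbered from the left starting at 1; $[\psi,m]$ denotes the occurrence of the subformula $\psi$ beginning at the $m$-th symbol, and $\phi(\beta/[\psi,m])$ the result of replacing that occurrence by $\beta$. Natural deduction system of $\mathbf{CPL}^+$ ($\Gamma\vdash\phi$ iff some derivation of $\phi$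 has undischarged assumptions in $\Gamma$; metavariables range over all formulas, axioms are specific formulas, no substitution rule). Axiom: $p_i\otimes\neg p_i$ (each $i$). Rules: standard $\wedge$-introduction/elimination; from $\phi$ infer $\phi\otimes\psi$ if $\psi$ does not contain $\mathrm{NE}$; from $\phi$ infer $\phi\otimes\phi$; from $\phi\otimes\psi$, a derivation of $\alpha$ from $\phi$ and one from $\psi$, infer $\alpha$ (discharging $\phi,\psi$), provided $\alpha$ is classical and the other undischarged assumptions of both subderivations are classical; from $\phi\otimes\psi$ and a derivation of $\chi$ from $\psi$ (discharged) infer $\phi\otimes\chi$, provided the other undischarged assumptions of that subderivation are classical; from $\phi\otimes\psi$ infer $\psi\otimes\phi$; from $\phi\otimes(\psi\otimes\chi)$ infer $(\phi\otimes\psi)\otimes\chi$; from $p_i\wedge\neg p_i$ infer $\bot$; from $\phi\otimes\bot$ infer $\phi$; from $\bot\wedge\mathrm{NE}$ infer any $\phi$; from $\phi\otimes(\bot\wedge\mathrm{NE})$ infer $\bot\wedge\mathrm{NE}$; from $\Theta^*_X\wedge\Theta^*_Y$ infer $\bot\wedge\mathrm{NE}$ for distinct teams $X,Y$ on the same finite index set; from $\alpha\wedge(\psi\otimes\chi)$ infer $(\alpha\wedge\psi)\otimes(\alpha\wedge\chi)$ for classical $\alpha$; Strong elimination 1: given a finite index set $N$ with $Y_1,\dots,Y_k$ all nonempty teams on $N$, and an occurrence $[\mathrm{NE},m]$ in $\phi$: from $\phi$ and derivations of $\theta$ from each $\phi(\Theta^*_{Y_j}/[\mathrm{NE},m])$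 (discharged), infer $\theta$; Strong elimination 2: for an occurrence $[\psi,m]$ of a subformula of $\phi$: from $\phi$, a derivation of $\theta$ from $\phi(\psi\wedge\bot/[\psi,m])$ and one from $\phi(\psi\wedge\mathrm{NE}/[\psi,m])$ (discharged), infer $\theta$. *)

(* Defs.v *)
From mathcomp Require Import all_boot finmap.
From mathcomp Require Import boolp classical_sets.

Set Implicit Arguments.
Unset Strict Implicit.
Unset Printing Implicit Defensive.

Local Open Scope classical_set_scope.

Inductive form : Type :=
| Var of nat
| NVar of nat
| Bot
| NE
| And of form & form
| Tens of form & form.

Fixpoint classical (f : form) : bool :=
  match f with
  | NE => false
  | And f g | Tens f g => classical f && classical g
  | _ => true
  end.

Definition team : Type := set (nat -> bool).

Fixpoint sat (X : team) (f : form) : Prop :=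
  match f with
  | Var i => forall s, X s -> s i = true
  | NVar i => forall s, X s -> s i = false
  | Bot => X = set0
  | NE => X <> set0
  | And f g => sat X f /\ sat X g
  | Tens f g => exists Y Z : team,
      [/\ Y `<=` X, Z `<=` X, X = Y `|` Z, sat Y f & sat Z g]
  end.

Definition entails (f g : form) : Prop := forall X : team, sat X f -> sat X g.

(* Iterated tensors and conjunctions are nested to the right, and the members
   of finite sets are listed in the fixed order of their library enumeration. *)

Fixpoint bigtens (fs : seq form) : form :=
  match fs with
  | [::] => Bot
  | [:: f] => f
  | f :: fs' => Tens f (bigtens fs')
  end.

Definition literal (i : nat) (b : bool) : form := if b then Var i else NVar i.

Definition team_on (N : {fset nat}) : Type := {fset {ffun N -> bool}}.

Definition theta_val (N : {fset nat}) (s : {ffun N -> bool}) : form :=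
  foldr And NE [seq literal (val i) (s i) | i <- enum {: N}].

Definition Theta (N : {fset nat}) (X : team_on N) : form :=
  bigtens [seq theta_val s | s <- enum_fset X].

Inductive symbol : Type :=
| SymVar of nat | SymNeg | SymBot | SymNE | SymAnd | SymTens | SymL | SymR.

(* Compound formulas are fully parenthesised, so that at most one subformula
   occurrence begins at any given symbol. *)
Fixpoint string_of (f : form) : seq symbol :=
  match f with
  | Var i => [:: SymVar i]
  | NVar i => [:: SymNeg; SymVar i]
  | Bot => [:: SymBot]
  | NE => [:: SymNE]
  | And f g => SymL :: string_of f ++ SymAnd :: string_of g ++ [:: SymR]
  | Tens f g => SymL :: string_of f ++ SymTens :: string_of g ++ [:: SymR]
  end.

(* The subformula of f beginning at the m-th symbol of f, counting from 1.
   Negated variables are atomic: Var i is not a subformula of NVar i. *)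
Fixpoint sub_at (f : form) (m : nat) : option form :=
  if m == 1 then Some f else
  match f with
  | And f g | Tens f g =>
      if m <= (size (string_of f)).+1 then sub_at f m.-1
      else sub_at g (m - (size (string_of f)).+2)
  | _ => None
  end.

(* Only meaningful when a subformula of f begins at the m-th symbol. *)
Fixpoint replace_at (f : form) (m : nat) (b : form) : form :=
  if m == 1 then b else
  match f with
  | And f g =>
      if m <= (size (string_of f)).+1 then And (replace_at f m.-1 b) g
      else And f (replace_at g (m - (size (string_of f)).+2) b)
  | Tens f g =>
      if m <= (size (string_of f)).+1 then Tens (replace_at f m.-1 b) g
      else Tens f (replace_at g (m - (size (string_of f)).+2) b)
  | _ => f
  end.

Lemma sub_at_string (f psi b : form) (m : nat) : sub_at f m = Some psi ->
  exists u v : seq symbol, [/\ m = (size u).+1,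
    string_of f = u ++ string_of psi ++ v &
    string_of (replace_at f m b) = u ++ string_of b ++ v].
Proof.
have here g : Some g = Some psi -> exists u v : seq symbol,
    [/\ 1 = (size u).+1, string_of g = u ++ string_of psi ++ v &
        string_of b = u ++ string_of b ++ v].
  by case=> ->; exists [::], [::]; rewrite /= !cats0.
elim: f m => [i|i|||f IHf g IHg|f IHf g IHg] m /=; case: eqP => [->|m1] //;
  try exact: here.
all: case: leqP => [_ /IHf|ltm /IHg] [u [v [mE Ef Eb]]].
1,3: exists (SymL :: u); eexists; split;
  [by case: m m1 mE {Eb} => [|[|m]] //= _ [->]
  |by rewrite /= Ef -!catA|by rewrite /= Eb -!catA].
1: exists (SymL :: string_of f ++ SymAnd :: u), (v ++ [:: SymR]).
2: exists (SymL :: string_of f ++ SymTens :: u), (v ++ [:: SymR]).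
all: split; [|by rewrite /= Ef -!catA|by rewrite /= Eb -!catA].
all: by rewrite -(subnK ltm) mE /= size_cat /= addSn !addnS addnC.
Qed.

(* deriv A f: there is a derivation of f whose set of undischarged assumptions
   is exactly A. Discharging an assumption that was not used is allowed. *)
Inductive deriv : set form -> form -> Prop :=
| d_assume f :
    deriv [set f] f
| d_excluded_middle i :
    deriv set0 (Tens (Var i) (NVar i))
| d_and_intro A B f g :
    deriv A f -> deriv B g -> deriv (A `|` B) (And f g)
| d_and_elim_l A f g :
    deriv A (And f g) -> deriv A f
| d_and_elim_r A f g :
    deriv A (And f g) -> deriv A g
| d_tens_intro A f g :
    classical g -> deriv A f -> deriv A (Tens f g)
| d_tens_dup A f :
    deriv A f -> deriv A (Tens f f)
| d_tens_elim A B C f g a :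
    classical a ->
    (forall h, (B `\ f) h -> classical h) ->
    (forall h, (C `\ g) h -> classical h) ->
    deriv A (Tens f g) -> deriv B a -> deriv C a ->
    deriv (A `|` (B `\ f) `|` (C `\ g)) a
| d_tens_sub A B f g h :
    (forall k, (B `\ g) k -> classical k) ->
    deriv A (Tens f g) -> deriv B h ->
    deriv (A `|` (B `\ g)) (Tens f h)
| d_tens_comm A f g :
    deriv A (Tens f g) -> deriv A (Tens g f)
| d_tens_assoc A f g h :
    deriv A (Tens f (Tens g h)) -> deriv A (Tens (Tens f g) h)
| d_bot_intro A i :
    deriv A (And (Var i) (NVar i)) -> deriv A Bot
| d_bot_elim A f :
    deriv A (Tens f Bot) -> deriv A f
| d_contr_elim A f :
    deriv A (And Bot NE) -> deriv A f
| d_contr_tens A f :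
    deriv A (Tens f (And Bot NE)) -> deriv A (And Bot NE)
| d_contr_theta A (N : {fset nat}) (X Y : team_on N) :
    X <> Y -> deriv A (And (Theta X) (Theta Y)) -> deriv A (And Bot NE)
| d_distr A a f g :
    classical a -> deriv A (And a (Tens f g)) ->
    deriv A (Tens (And a f) (And a g))
| d_strong_elim1 A (N : {fset nat}) (B : team_on N -> set form) f m h :
    sub_at f m = Some NE ->
    deriv A f ->
    (forall Y : team_on N, Y <> fset0 -> deriv (B Y) h) ->
    deriv (A `|` \bigcup_(Y in [set Y : team_on N | Y <> fset0])
                    (B Y `\ replace_at f m (Theta Y))) h
| d_strong_elim2 A B C f g m h :
    sub_at f m = Some g ->
    deriv A f -> deriv B h -> deriv C h ->
    deriv (A `|` (B `\ replace_at f m (And g Bot))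
             `|` (C `\ replace_at f m (And g NE))) h.

Definition provable (G : set form) (f : form) : Prop :=
  exists2 A : set form, A `<=` G & deriv A f.

(* Main.v *)
Require Import Defs.
From mathcomp Require Import all_boot finmap.
From mathcomp Require Import boolp classical_sets zify.

(** Fix a finite index set [N] containing the variables of [phi] and [psi].
    Eliminating first [f] in favour of [f /\ Bot] and [f /\ NE], and then that
    [NE] in favour of the [Theta_Y], shows that any occurrence of [f] may be
    replaced by [f /\ Theta_Y], one case for each team [Y] on [N], empty or
    not.  So [phi |- psi] follows once [phi /\ Theta_Y |- psi] for all [Y].  If
    [Y] satisfies [phi], it satisfies [psi], and then [Theta_Y |- psi] by
    induction on [psi].  Otherwise [phi /\ Theta_Y] is contradictory, by
    induction on [phi]; for [phi = f * g], split both [f] and [g] into cases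
    [Theta_Y1], [Theta_Y2] and note that [Theta_Y1 * Theta_Y2] proves
    [Theta_(Y1 u Y2)], which is incompatible with [Theta_Y] unless
    [Y1 u Y2 = Y]. *)

Set Implicit Arguments.
Unset Strict Implicit.
Unset Printing Implicit Defensive.

Local Open Scope classical_set_scope.

(** A derivation whose only premise gets discharged leaves no open assumptions, so the side
    conditions asking for classical ones hold vacuously. All reasoning below is therefore by chains
    of single-premise steps. *)
Definition proves (f g : form) : Prop := provable [set f] g.

Local Notation "f |-- g" := (proves f g) (at level 70, no associativity).

Definition contr : form := And Bot NE.

(** * Single-premise derivability *)

Lemma discharge_all (A : set form) (f : form) : A `<=` [set f] -> A `\ f = set0.
Proof. by move=> Af; apply/seteqP; split=> h //= [/Af]. Qed.

Lemma proves_refl f : f |-- f.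
Proof. by exists [set f] => //; exact: d_assume. Qed.

Lemma proves_tens_sub f g h : g |-- h -> Tens f g |-- Tens f h.
Proof.
move=> [B Bg dh]; exists ([set Tens f g] `|` (B `\ g)).
  by rewrite (discharge_all Bg) setU0.
apply: d_tens_sub => //; last exact: d_assume.
by rewrite (discharge_all Bg).
Qed.

(* A cut on [g] is a substitution inside [Bot * g]. *)
Lemma proves_trans g f h : f |-- g -> g |-- h -> f |-- h.
Proof.
move=> [A Af dg] [B Bg dh]; exists (A `|` (B `\ g)).
  by rewrite (discharge_all Bg) setU0.
apply/d_bot_elim/d_tens_comm/(d_tens_sub _ _ dh).
  by rewrite (discharge_all Bg).
exact/d_tens_comm/d_tens_intro.
Qed.

Lemma proves_rule f g :
  (forall A, deriv A f -> deriv A g) -> f |-- g.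
Proof. by move=> fg; exists [set f] => //; apply/fg/d_assume. Qed.

Lemma and_intro f g h : f |-- g -> f |-- h -> f |-- And g h.
Proof.
move=> [A Af dg] [B Bf dh]; exists (A `|` B); first by move=> k [/Af|/Bf].
exact: d_and_intro.
Qed.

Lemma and_l f g : And f g |-- f.
Proof. by apply: proves_rule => A; apply: d_and_elim_l. Qed.

Lemma and_r f g : And f g |-- g.
Proof. by apply: proves_rule => A; apply: d_and_elim_r. Qed.

Lemma and_mono f f' g g' : f |-- f' -> g |-- g' -> And f g |-- And f' g'.
Proof.
by move=> ff gg; apply: and_intro;
  [apply: proves_trans (and_l _ _) ff|apply: proves_trans (and_r _ _) gg].
Qed.

Lemma and_comm f g : And f g |-- And g f.
Proof. by apply: and_intro; [exact: and_r|exact: and_l]. Qed.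

Lemma tens_comm f g : Tens f g |-- Tens g f.
Proof. by apply: proves_rule => A; apply: d_tens_comm. Qed.

Lemma tens_assoc f g h : Tens f (Tens g h) |-- Tens (Tens f g) h.
Proof. by apply: proves_rule => A; apply: d_tens_assoc. Qed.

Lemma tens_mono f f' g g' : f |-- f' -> g |-- g' -> Tens f g |-- Tens f' g'.
Proof.
move=> ff gg; apply: (proves_trans (proves_tens_sub _ gg)).
apply: (proves_trans (tens_comm _ _)).
by apply: (proves_trans (proves_tens_sub _ ff)); exact: tens_comm.
Qed.

(** The rules reassociate in one direction; conjugating by commutativity gives the other. *)
Lemma tens_assoc' f g h : Tens (Tens f g) h |-- Tens f (Tens g h).
Proof.
apply: (proves_trans (tens_comm _ _)); apply: (proves_trans (tens_assoc _ _ _)).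
apply: (proves_trans (tens_comm _ _)); apply: (proves_trans (tens_assoc _ _ _)).
exact: tens_comm.
Qed.

Lemma tens_swap f g h : Tens f (Tens g h) |-- Tens g (Tens f h).
Proof.
apply: (proves_trans (tens_assoc _ _ _)).
apply: proves_trans (tens_assoc' _ _ _).
by apply: tens_mono; [exact: tens_comm|exact: proves_refl].
Qed.

Lemma tens_dup f : f |-- Tens f f.
Proof. by apply: proves_rule => A; apply: d_tens_dup. Qed.

Lemma tens_bot f : f |-- Tens f Bot.
Proof. by apply: proves_rule => A; apply: d_tens_intro. Qed.

Lemma tens_bot' f : Tens f Bot |-- f.
Proof. by apply: proves_rule => A; apply: d_bot_elim. Qed.

Lemma bot_proves a : classical a -> Bot |-- a.
Proof.
by move=> ca; apply: proves_rule => A dA; apply/d_bot_elim/d_tens_comm/d_tens_intro.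
Qed.

Lemma tens_elim f g a : classical a -> f |-- a -> g |-- a -> Tens f g |-- a.
Proof.
move=> ca [B Bf fa] [C Cg ga].
exists ([set Tens f g] `|` (B `\ f) `|` (C `\ g)).
  by rewrite (discharge_all Bf) (discharge_all Cg) !setU0.
by apply: d_tens_elim => //; [rewrite (discharge_all Bf)
  |rewrite (discharge_all Cg)|exact: d_assume].
Qed.

Lemma tens_distr a f g :
  classical a -> And a (Tens f g) |-- Tens (And a f) (And a g).
Proof. by move=> ca; apply: proves_rule => A; apply: d_distr. Qed.

Lemma contr_proves f : contr |-- f.
Proof. by apply: proves_rule => A; apply: d_contr_elim. Qed.

Lemma tens_contr f : Tens contr f |-- contr.
Proof.
by apply: proves_rule => A dA; apply/d_contr_tens/d_tens_comm/dA.
Qed.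

(** * Case splits by strong elimination *)

Lemma strong_elim1 (N : {fset nat}) f m h :
  sub_at f m = Some NE ->
  (forall Y : team_on N, Y <> fset0 -> replace_at f m (Theta Y) |-- h) ->
  f |-- h.
Proof.
move=> fm H.
(* The rule wants assumption sets for all teams at once; the empty team receives the dummy
   [set0]. *)
have /choice [B BH] (Y : team_on N) : exists B : set form, Y <> fset0 ->
    B `<=` [set replace_at f m (Theta Y)] /\ deriv B h.
  have [->|/eqP /H [B Bs dB]] := eqVneq Y fset0; first by exists set0.
  by exists B.
exists ([set f] `|` \bigcup_(Y in [set Y : team_on N | Y <> fset0])
                      (B Y `\ replace_at f m (Theta Y))); last first.
  by apply: d_strong_elim1 => //; [exact: d_assume|move=> Y /BH []].
by move=> k [//|[Y /BH [BY _]]]; rewrite discharge_all.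
Qed.

Lemma strong_elim2 f g m h :
  sub_at f m = Some g ->
  replace_at f m (And g Bot) |-- h -> replace_at f m (And g NE) |-- h ->
  f |-- h.
Proof.
move=> fm [B Bs dB] [C Cs dC].
exists ([set f] `|` (B `\ replace_at f m (And g Bot))
                `|` (C `\ replace_at f m (And g NE))).
  by rewrite (discharge_all Bs) (discharge_all Cs) !setU0.
by apply: d_strong_elim2 fm _ _ _ => //; exact: d_assume.
Qed.

Lemma ne_cases f h : And f Bot |-- h -> And f NE |-- h -> f |-- h.
Proof.
move=> f0 f1; apply: (@strong_elim2 f f 1); by [case: (f)|move: f0 f1; case: (f)].
Qed.

Lemma replace_at_nested f g b m k :
  sub_at f m = Some g -> k < size (string_of b) ->
  sub_at (replace_at f m b) (m + k) = sub_at b k.+1 /\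
  forall c, replace_at (replace_at f m b) (m + k) c
            = replace_at f m (replace_at b k.+1 c).
Proof.
elim: f m => [i|i|||f1 IH1 f2 IH2|f1 IH1 f2 IH2] m /=;
  case: (eqVneq m 1) => [->|m1] //= fm kb; rewrite ?add1n //.
all: case: leqP fm => lem fm; have [u [v [mE fE bE]]] := sub_at_string b fm.
(* The new length of the modified factor shows that [m + k] still falls inside it. *)
all: move: (congr1 size bE); rewrite !size_cat => sb /=.
all: rewrite ifF; [|by lia].
1,3: rewrite ifT; [|by lia].
1,2: have -> : (m + k).-1 = m.-1 + k by lia.
1,2: by have [-> E] := IH1 _ fm kb; split=> // c;
  rewrite ifF ?ifT ?E //; lia.
all: rewrite ifF; [|by lia].
all: have -> : m + k - (size (string_of f1)).+2
             = m - (size (string_of f1)).+2 + k by lia.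
all: by have [-> E] := IH2 _ fm kb; split=> // c; rewrite !ifF ?E //; lia.
Qed.

Lemma Theta0 (N : {fset nat}) : Theta (fset0 : team_on N) = Bot.
Proof. by []. Qed.

Lemma Theta_cases_at (N : {fset nat}) f g m h : sub_at f m = Some g ->
  (forall Y : team_on N, replace_at f m (And g (Theta Y)) |-- h) -> f |-- h.
Proof.
(* The [Bot] branch is the case of the empty team, since its [Theta] is [Bot]. *)
move=> fm H; apply: (strong_elim2 fm); first by rewrite -(Theta0 N).
(* In [And g NE] the symbol [NE] comes after a bracket, the string of [g] and the connective: an
   offset of [size (string_of g) + 2]. *)
have kb : (size (string_of g)).+2 < size (string_of (And g NE)).
  by rewrite /= size_cat /=; lia.
have [sE rE] := replace_at_nested fm kb.
have pos : ((size (string_of g)).+3 <= (size (string_of g)).+1) = false by lia.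
have sub1 : (size (string_of g)).+3 - (size (string_of g)).+2 = 1 by lia.
apply: (strong_elim1 (N := N) (m := m + (size (string_of g)).+2)).
  by rewrite sE /= pos sub1.
by move=> Y _; rewrite rE /= pos sub1; exact: H.
Qed.

Lemma sub_at1 f : sub_at f 1 = Some f.
Proof. by case: f. Qed.

Lemma replace_at1 f b : replace_at f 1 b = b.
Proof. by case: f. Qed.

Lemma Theta_cases (N : {fset nat}) f h :
  (forall Y : team_on N, And f (Theta Y) |-- h) -> f |-- h.
Proof.
move=> H; apply: (Theta_cases_at (sub_at1 f) (N := N)) => Y.
by rewrite replace_at1.
Qed.

(** [d_tens_elim] reaches only classical conclusions, so a factor of a tensor is split in place by
    strong elimination. The conjunct [c] will carry the [Theta] of the whole team. *)
Lemma tens_Theta_cases (N : {fset nat}) f g c h :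
  (forall Y : team_on N, And (Tens (And f (Theta Y)) g) c |-- h) ->
  And (Tens f g) c |-- h.
Proof.
have f_gt0 : 0 < size (string_of f) by case: (f).
(* Two opening brackets precede [f], which thus begins at symbol 3. *)
move=> H; apply: (@Theta_cases_at N _ f 3) => [|Y] /=; rewrite size_cat /=.
  by rewrite !ifT ?sub_at1 //; lia.
by rewrite !ifT ?replace_at1 //; by [exact: H|lia].
Qed.

Lemma tens_NE f : Tens NE f |-- NE.
Proof.
apply: ne_cases; last exact: and_r.
(* Distributing the classical [Bot] turns the factor [NE] into [contr], which absorbs the tensor. *)
apply: (proves_trans (and_comm _ _)); apply: (proves_trans (tens_distr _ _ _)) => //.
by apply: (proves_trans (tens_contr _)); exact: contr_proves.
Qed.

(** * Iterated tensors of idempotent formulas *)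

(** Unlike [bigtens], this ends in [Bot] even on nonempty lists, which spares inductions the
    singleton case. *)
Definition tensor (fs : seq form) : form := foldr Tens Bot fs.

Lemma bigtens_tensor fs : bigtens fs |-- tensor fs.
Proof.
elim: fs => [|f [|g fs] IH]; [exact: proves_refl|exact: tens_bot|].
by apply: tens_mono IH; exact: proves_refl.
Qed.

Lemma tensor_bigtens fs : tensor fs |-- bigtens fs.
Proof.
elim: fs => [|f [|g fs] IH]; [exact: proves_refl|exact: tens_bot'|].
by apply: tens_mono IH; exact: proves_refl.
Qed.

Lemma tensor_cat fs gs : tensor (fs ++ gs) |-- Tens (tensor fs) (tensor gs).
Proof.
elim: fs => [|f fs IH] /=; first exact: proves_trans (tens_bot _) (tens_comm _ _).
by apply: proves_trans (tens_assoc _ _ _); apply: tens_mono IH; exact: proves_refl.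
Qed.

Lemma tensor_cat' fs gs : Tens (tensor fs) (tensor gs) |-- tensor (fs ++ gs).
Proof.
elim: fs => [|f fs IH] /=.
  exact: proves_trans (tens_comm _ _) (tens_bot' _).
apply: (proves_trans (tens_assoc' _ _ _)).
by apply: tens_mono IH; exact: proves_refl.
Qed.

Section IdempotentTensor.
Variables (I : eqType) (F : I -> form).
Hypothesis F_idem : forall i, Tens (F i) (F i) |-- F i.

Local Notation tensF r := (tensor [seq F i | i <- r]).

Lemma tensor_expose i r : i \in r -> tensF r |-- Tens (F i) (tensF r).
Proof.
elim: r => [//|j r IH]; rewrite inE /= => /predU1P [->|/IH {}IH].
  apply: proves_trans (tens_assoc' _ _ _).
  by apply: tens_mono (proves_refl _); exact: tens_dup.
apply: proves_trans (tens_swap _ _ _).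
by apply: tens_mono IH; exact: proves_refl.
Qed.

Lemma tensor_absorb i r : i \in r -> Tens (F i) (tensF r) |-- tensF r.
Proof.
elim: r => [//|j r IH]; rewrite inE /= => /predU1P [->|/IH {}IH].
  apply: (proves_trans (tens_assoc _ _ _)).
  exact: tens_mono (proves_refl _).
apply: (proves_trans (tens_swap _ _ _)).
by apply: tens_mono IH; exact: proves_refl.
Qed.

(** Order and multiplicity do not matter: copies of the members of [r'] are duplicated out of [r],
    the two blocks are swapped, and the members of [r] are absorbed into [r'] by idempotence. *)
Lemma tensor_eq_mem r r' : r =i r' -> tensF r |-- tensF r'.
Proof.
have expose s t : {subset s <= t} -> tensF t |-- tensF (s ++ t).
  elim: s => [_|i s IH st] /=; first exact: proves_refl.
  have it : i \in t by apply: st; rewrite mem_head.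
  apply: (proves_trans (tensor_expose it)); apply: tens_mono (proves_refl _) _.
  by apply: IH => j js; apply: st; rewrite inE js orbT.
have absorb s t : {subset s <= t} -> tensF (s ++ t) |-- tensF t.
  elim: s => [_|i s IH st] /=; first exact: proves_refl.
  have it : i \in t by apply: st; rewrite mem_head.
  apply: proves_trans (tensor_absorb it); apply: tens_mono (proves_refl _) _.
  by apply: IH => j js; apply: st; rewrite inE js orbT.
move=> rr'; apply: (@proves_trans (tensF (r' ++ r))).
  by apply: expose => i; rewrite rr'.
apply: (@proves_trans (tensF (r ++ r'))); last by apply: absorb => i; rewrite rr'.
rewrite !map_cat; apply: (proves_trans (tensor_cat _ _)).
by apply: (proves_trans (tens_comm _ _)); exact: tensor_cat'.
Qed.

End IdempotentTensor.

(** * The formulas Theta *)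

Lemma classical_literal i b : classical (literal i b).
Proof. by case: b. Qed.

Section Theta.
Variable N : {fset nat}.
Implicit Types (s : {ffun N -> bool}) (Y Z : team_on N).

(** Teams consist of total valuations, so valuations on [N] get the default value [false]
    elsewhere. *)
Definition extend s (i : nat) : bool := if insub i is Some j then s j else false.

Lemma extendE s (j : N) : extend s (val j) = s j.
Proof. by rewrite /extend valK. Qed.

Lemma theta_val_literal s i : i \in N -> theta_val s |-- literal i (extend s i).
Proof.
move=> iN; have [j ->] : exists j : N, i = val j by exists [` iN]%fset.
rewrite extendE /theta_val; have: j \in enum {: N} by rewrite mem_enum.
elim: (enum _) => [//|k r IH].
rewrite inE /= => /predU1P [->|/IH {}IH]; first exact: and_l.
exact: proves_trans (and_r _ _) IH.
Qed.

Lemma theta_val_NE s : theta_val s |-- NE.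
Proof.
rewrite /theta_val; elim: (enum _) => [|j r IH] /=; first exact: proves_refl.
exact: proves_trans (and_r _ _) IH.
Qed.

(** Contracting a tensor fails for general formulas, but here each conjunct is a literal, handled by
    [tens_elim] since it is classical, or [NE], handled by [tens_NE]. *)
Lemma theta_val_idem s : Tens (theta_val s) (theta_val s) |-- theta_val s.
Proof.
rewrite /theta_val; elim: (enum _) => [|j r IH] /=; first exact: tens_NE.
apply: and_intro.
  by apply: tens_elim; [exact: classical_literal|exact: and_l..].
by apply: proves_trans IH; apply: tens_mono; exact: and_r.
Qed.

(** The enumeration of a union and the concatenated enumerations have the same members, though not
    the same order or multiplicities. *)
Lemma Theta_setU Y Z : Theta (Y `|` Z)%fset |-- Tens (Theta Y) (Theta Z).
Proof.
apply: (proves_trans (bigtens_tensor _)).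
apply: proves_trans (tens_mono (tensor_bigtens _) (tensor_bigtens _)).
apply: proves_trans (tensor_cat _ _); rewrite -map_cat.
by apply: (tensor_eq_mem theta_val_idem) => s; rewrite mem_cat -in_fsetU.
Qed.

Lemma Theta_setU' Y Z : Tens (Theta Y) (Theta Z) |-- Theta (Y `|` Z)%fset.
Proof.
apply: proves_trans (tensor_bigtens _).
apply: (proves_trans (tens_mono (bigtens_tensor _) (bigtens_tensor _))).
apply: (proves_trans (tensor_cat' _ _)); rewrite -map_cat.
by apply: (tensor_eq_mem theta_val_idem) => s; rewrite mem_cat -in_fsetU.
Qed.

Lemma Theta_expose Y s : s \in Y -> Theta Y |-- Tens (theta_val s) (Theta Y).
Proof.
move=> sY; apply: (proves_trans (bigtens_tensor _)).
apply: (proves_trans (tensor_expose _ sY)).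
by apply: tens_mono (tensor_bigtens _); exact: proves_refl.
Qed.

Lemma Theta_NE Y : Y <> fset0 -> Theta Y |-- NE.
Proof.
move=> /eqP /fset0Pn [s sY]; apply: (proves_trans (Theta_expose sY)).
apply: proves_trans (tens_NE (Theta Y)).
by apply: tens_mono (proves_refl _); exact: theta_val_NE.
Qed.

Lemma Theta_classical Y a : classical a ->
  (forall s, s \in Y -> theta_val s |-- a) -> Theta Y |-- a.
Proof.
move=> ca Ya; apply: (proves_trans (bigtens_tensor _)).
have {}Ya : forall s, s \in enum_fset Y -> theta_val s |-- a by exact: Ya.
elim: (enum_fset Y) Ya => [_|s r IH Ya] /=; first exact: bot_proves.
apply: tens_elim => //; first by apply: Ya; rewrite mem_head.
by apply: IH => t tr; apply: Ya; rewrite inE tr orbT.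
Qed.

(** One bad valuation suffices: once [theta_val s] is exposed and [a] distributed, that factor
    yields both [Bot] and [NE], and the contradiction spreads to the whole tensor. *)
Lemma Theta_contr Y s a : classical a -> s \in Y ->
  And a (theta_val s) |-- Bot -> And a (Theta Y) |-- contr.
Proof.
move=> ca sY aF.
apply: (proves_trans (and_mono (proves_refl _) (Theta_expose sY))).
apply: (proves_trans (tens_distr _ _ ca)).
apply: proves_trans (tens_contr (And a (Theta Y))).
apply: tens_mono (proves_refl _); apply: and_intro aF _.
exact: proves_trans (and_r _ _) (theta_val_NE s).
Qed.

Lemma literal_contr i b c : b <> c -> And (literal i b) (literal i c) |-- Bot.
Proof.
have pn : And (Var i) (NVar i) |-- Bot.
  by apply: proves_rule => A; apply: d_bot_intro.
by case: b; case: c => // _; apply: proves_trans (and_comm _ _) pn.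
Qed.

Lemma Theta_literal_contr Y s i b : i \in N -> s \in Y -> extend s i <> b ->
  And (literal i b) (Theta Y) |-- contr.
Proof.
move=> iN sY sb; apply: (Theta_contr (classical_literal _ _) sY).
apply: proves_trans (literal_contr i (nesym sb)).
by apply: and_mono (proves_refl _) _; exact: theta_val_literal.
Qed.

(** * Semantics on finite teams *)

(** This mirrors [sat] on the finite teams that index [Theta], so that inductions on formulas can
    match teams with their [Theta]. *)
Fixpoint fsat (Y : team_on N) (f : form) : Prop :=
  match f with
  | Var i => forall s, s \in Y -> extend s i = true
  | NVar i => forall s, s \in Y -> extend s i = false
  | Bot => Y = fset0
  | NE => Y <> fset0
  | And f g => fsat Y f /\ fsat Y g
  | Tens f g => exists Y1 Y2 : team_on N,
      [/\ Y = (Y1 `|` Y2)%fset, fsat Y1 f & fsat Y2 g]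
  end.

Fixpoint vars_in (f : form) : bool :=
  match f with
  | Var i | NVar i => i \in N
  | And f g | Tens f g => vars_in f && vars_in g
  | _ => true
  end.

Lemma Theta_proves f Y : vars_in f -> fsat Y f -> Theta Y |-- f.
Proof.
elim: f Y => [i|i|||f IHf g IHg|f IHf g IHg] Y /=.
- move=> iN Yi; apply: Theta_classical => // s /Yi si.
  by have := theta_val_literal s iN; rewrite si.
- move=> iN Yi; apply: Theta_classical => // s /Yi si.
  by have := theta_val_literal s iN; rewrite si.
- by move=> _ ->; exact: proves_refl.
- by move=> _; exact: Theta_NE.
- by move=> /andP [vf vg] [Yf Yg]; apply: and_intro; [exact: IHf|exact: IHg].
- move=> /andP [vf vg] [Y1 [Y2 [-> Yf Yg]]].
  by apply: (proves_trans (Theta_setU _ _)); apply: tens_mono; [exact: IHf|exact: IHg].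
Qed.

Lemma Theta_refutes f Y : vars_in f -> ~ fsat Y f -> And f (Theta Y) |-- contr.
Proof.
elim: f Y => [i|i|||f IHf g IHg|f IHf g IHg] Y /=.
- move=> iN /existsNP [s /not_implyP [sY si]].
  exact: (@Theta_literal_contr Y s i true).
- move=> iN /existsNP [s /not_implyP [sY si]].
  exact: (@Theta_literal_contr Y s i false).
- by move=> _ Y0; apply: and_mono (proves_refl _) _; exact: Theta_NE.
- by move=> _ /contrapT ->; exact: and_comm.
- move=> /andP [vf vg] /not_andP [Yf|Yg].
    by apply: proves_trans (IHf Y vf Yf); apply: and_mono (and_l _ _) (proves_refl _).
  by apply: proves_trans (IHg Y vg Yg); apply: and_mono (and_r _ _) (proves_refl _).
move=> /andP [vf vg] nY.
apply: (@tens_Theta_cases N) => Y1.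
(* The case split acts on the left factor, so [g] is moved there before its turn. *)
apply: proves_trans (_ : And (Tens g (And f (Theta Y1))) (Theta Y) |-- contr).
  by apply: and_mono (proves_refl _); exact: tens_comm.
apply: (@tens_Theta_cases N) => Y2.
(* If a piece fails its formula, the induction hypothesis makes that factor [contr]. *)
have [Y1f|/(IHf _ vf) cf] := pselect (fsat Y1 f); last first.
  apply: (proves_trans (and_l _ _)); apply: (proves_trans (tens_comm _ _)).
  apply: proves_trans (tens_contr (And g (Theta Y2))).
  exact: tens_mono (proves_refl _).
have [Y2g|/(IHg _ vg) cg] := pselect (fsat Y2 g); last first.
  apply: (proves_trans (and_l _ _)).
  apply: proves_trans (tens_contr (And f (Theta Y1))).
  exact: tens_mono (proves_refl _).
apply: (@proves_trans (And (Theta (Y1 `|` Y2)%fset) (Theta Y))).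
  apply: and_mono (proves_refl _); apply: proves_trans (Theta_setU' _ _).
  apply: (proves_trans (tens_comm _ _)).
  by apply: tens_mono; exact: and_r.
(* Were the two teams equal, [Y1] and [Y2] would witness that [Y] satisfies the tensor. *)
apply: proves_rule => A; apply: d_contr_theta => YE.
by apply: nY; exists Y1, Y2; rewrite YE.
Qed.

Lemma fsat_sat f Y : fsat Y f -> sat [set extend s | s in [set` Y]] f.
Proof.
elim: f Y => [i|i|||f IHf g IHg|f IHf g IHg] Y /=.
- by move=> Yi _ [s sY <-]; exact: Yi.
- by move=> Yi _ [s sY <-]; exact: Yi.
- by move=> ->; apply/seteqP; split=> // t [s].
- move=> /eqP /fset0Pn [s sY]; apply/eqP/set0P.
  by exists (extend s); exists s.
- by move=> [/IHf ? /IHg ?].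
move=> [Y1 [Y2 [-> /IHf Y1f /IHg Y2g]]].
exists [set extend s | s in [set` Y1]], [set extend s | s in [set` Y2]].
split=> //.
- by move=> _ [s sY <-]; exists s => //=; rewrite in_fsetU sY.
- by move=> _ [s sY <-]; exists s => //=; rewrite in_fsetU sY orbT.
apply/seteqP; split=> t.
  by move=> [s /= + <-]; rewrite in_fsetU => /orP [sY|sY]; [left|right]; exists s.
by move=> [] [s sY <-]; exists s => //=; rewrite in_fsetU sY ?orbT.
Qed.

Definition restrict (t : nat -> bool) : {ffun N -> bool} := [ffun j => t (val j)].

(** The image of a possibly infinite team under [restrict], made a finite set by filtering all
    valuations on [N] with a classically decided predicate. *)
Definition restrict_team (X : team) : team_on N :=
  [fset s in enum {: {ffun N -> bool}}
     | `[< exists2 t, X t & restrict t = s >]]%fset.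

Lemma in_restrict_team X s : s \in restrict_team X <-> (restrict @` X) s.
Proof. by rewrite !inE mem_enum /=; split=> /asboolP. Qed.

Lemma extendK s : restrict (extend s) = s.
Proof. by apply/ffunP => j; rewrite ffunE extendE. Qed.

Lemma extend_restrict t i : i \in N -> extend (restrict t) i = t i.
Proof. by move=> iN; rewrite -[i]/(val [` iN]%fset) extendE ffunE. Qed.

Lemma restrict_team_extend Y : restrict_team [set extend s | s in [set` Y]] = Y.
Proof.
apply/fsetP => s; apply/idP/idP => [/in_restrict_team [_ [u uY <-] <-]|sY].
  by rewrite extendK.
by apply/in_restrict_team; exists (extend s); [exists s|exact: extendK].
Qed.

(** Restriction keeps the values of the variables in [N], and taking images commutes with unions. *)
Lemma sat_fsat f X : vars_in f -> sat X f -> fsat (restrict_team X) f.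
Proof.
elim: f X => [i|i|||f IHf g IHg|f IHf g IHg] X /=.
- by move=> iN Xi s /in_restrict_team [t tX <-]; rewrite extend_restrict ?Xi.
- by move=> iN Xi s /in_restrict_team [t tX <-]; rewrite extend_restrict ?Xi.
- move=> _ ->; apply/fsetP => s; rewrite in_fset0; apply/negP.
  by move=> /in_restrict_team [].
- move=> _ /eqP /set0P [t tX]; apply/eqP/fset0Pn; exists (restrict t).
  by apply/in_restrict_team; exists t.
- by move=> /andP [vf vg] [/(IHf _ vf) ? /(IHg _ vg) ?].
move=> /andP [vf vg] [Y [Z [_ _ -> /(IHf _ vf) Yf /(IHg _ vg) Zg]]].
exists (restrict_team Y), (restrict_team Z); split=> //.
apply/fsetP => s; rewrite in_fsetU; apply/idP/orP.
  by move=> /in_restrict_team [t [tY|tZ] <-]; [left|right];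
    apply/in_restrict_team; exists t.
by move=> [] /in_restrict_team [t tX <-]; apply/in_restrict_team; exists t => //;
  [left|right].
Qed.

(** Pass to the extended team, apply the entailment there, and restrict: the round trip returns [Y]
    itself. *)
Lemma entails_fsat f g Y : vars_in g -> entails f g -> fsat Y f -> fsat Y g.
Proof.
move=> vg fg /fsat_sat /fg /(sat_fsat vg).
by rewrite restrict_team_extend.
Qed.

End Theta.

(** * Choice of the index set and completeness *)

Fixpoint vars (f : form) : seq nat :=
  match f with
  | Var i | NVar i => [:: i]
  | And f g | Tens f g => vars f ++ vars g
  | _ => [::]
  end.

Lemma vars_in_vars (N : {fset nat}) f : {subset vars f <= N} -> vars_in N f.
Proof.
elim: f => [i|i|||f IHf g IHg|f IHf g IHg] //= sN; try exact/sN/mem_head.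
all: by rewrite IHf ?IHg // => i iv; apply: sN; rewrite mem_cat iv ?orbT.
Qed.

Theorem theorem5p16 (phi psi : form) :
  entails phi psi -> provable [set phi] psi.
Proof.
move=> phipsi; pose N := [fset i in vars phi ++ vars psi]%fset.
have vphi : vars_in N phi by apply: vars_in_vars => i iv; rewrite !inE iv.
have vpsi : vars_in N psi by apply: vars_in_vars => i iv; rewrite !inE iv orbT.
apply: (@Theta_cases N) => Y.
have [Yphi|Yphi] := pselect (fsat Y phi).
  apply: proves_trans (and_r _ _) (Theta_proves vpsi _).
  exact: entails_fsat phipsi Yphi.
exact: proves_trans (Theta_refutes vphi Yphi) (contr_proves _).
Qed.
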